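(* Let $F$ be a field of characteristic not $2$ and not $3$, let $\alpha,t\in F$, and let $E$ be a vector space over $F$ endowed with a nondegenerate symmetric bilinear form $\langle\cdot,\cdot\rangle$. In the algebra $S(\alpha,t,E)$ with its generalized sharped cubic form, for all $r=r_0+v$, $s=s_0+u$, $q=q_0+w$ with $r_0,s_0,q_0\in Fz_1+Fz_2$ and $v,u,w\in E$ we have $$\Psi(r,s,q)=(2\alpha-1)(t-1)\big(\langle u,w\rangle v-\langle u,v\rangle w\big).$$
   Context: $S(\alpha,t,E)=Fz_1\oplus Fz_2\oplus E$ is the commutative algebra with $z_1^2=z_1$, $z_2^2=z_2$, $z_1z_2=0$, $ez_1=\alpha e$, $ez_2=(1-\alpha)e$, $ef=\langle e,f\rangle(z_1+tz_2)$ for $e,f\in E$. Write $\bar\alpha=1-\alpha$ and $c=z_1+z_2$. Its generalized sharped cubic form consists of the following maps ($a,b,k,l\in F$, $u,v\in E$): $N(az_1+bz_2+v)=ab(\alpha a+\bar\alpha b)-\langle v,v\rangle(\bar\alpha ta+\alpha b)$; $\Delta(az_1+bz_2+v,kz_1+lz_2+u)=\alpha(\alpha-1)(a-b)(k-l)-\langle u,v\rangle(\bar\alpha+\alpha t)$; $(az_1+bz_2+v)^\#=(\alpha a+\bar\alpha b)(bz_1+az_2)+(t-1)\langle v,v\rangle(-\bar\alpha z_1+\alpha z_2)-(\bar\alpha a+\alpha b)v$. Let $N(x,y,z)=N(x+y+z)-N(x+y)-N(x+z)-N(y+z)+N(x)+N(y)+N(z)$, $T(r)=N(r,c,c)/2$,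 $S(r,q)=N(r,q,c)$, $(r,q)=T(r)T(q)-S(r,q)-\Delta(r,q)$, and $r_\#q=(r+q)^\#-r^\#-q^\#$. Let $(r,s,q)=(rs)q-r(sq)$ be the associator. The map $\Psi$ is defined by $$\Psi(r,s,q)=(r,s,q)-\Delta(q,s)r+\Delta(r,s)q+\tfrac14\big(\Delta(q_\#s,r)-\Delta(r_\#s,q)+2T(r)\Delta(s,q)-2T(q)\Delta(r,s)+(q_\#s,r)-(r_\#s,q)\big)c .$$ *)

(* Defs.v *)
From mathcomp Require Export all_boot all_order all_algebra.
From mathcomp Require Import ring.

Set Implicit Arguments.
Unset Strict Implicit.
Unset Printing Implicit Defensive.

Import GRing.Theory.
Local Open Scope ring_scope.

(* The library's [nondegenerate] is restricted to finite-dimensional spaces,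
   whereas here the space may have arbitrary dimension. *)
Definition nondegenerate_form (F : fieldType) (E : lmodType F)
    (form : {symmetric E}) : Prop :=
  forall u : E, (forall v : E, form u v = 0) -> u = 0.

(* The space F z1 + F z2 + E: the triple (a, b, v) is a z1 + b z2 + v. *)
Definition Salg (F : fieldType) (E : lmodType F) : lmodType F :=
  (F^o * F^o * E)%type.

Section SAlgebra.
Variables (F : fieldType) (E : lmodType F).
Implicit Types (a b k l : F) (u v : E) (x y z r s q : Salg E).

Definition z1 : Salg E := (1, 0, 0).
Definition z2 : Salg E := (0, 1, 0).
Definition Sc : Salg E := z1 + z2.
Definition embE v : Salg E := (0, 0, v).

Definition z1coef x : F := x.1.1.
Definition z2coef x : F := x.1.2.
Definition vecE x : E := x.2.

Definition in_Fz1z2 x : Prop := exists a b : F, x = a *: z1 + b *: z2.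

Lemma Salg_decomp x : x = z1coef x *: z1 + z2coef x *: z2 + embE (vecE x).
Proof.
case: x => [[a b] v]; congr (_, _, _).
- by rewrite /z1coef /=; change (a = a * 1 + b * 0 + 0); ring.
- by rewrite /z2coef /=; change (b = a * 0 + b * 1 + 0); ring.
- by rewrite /= !scaler0 !add0r.
Qed.

Variables (alpha t : F) (form : {symmetric E}).
Local Notation "''[' u , v ]" := (form u v).
Local Notation alphab := (1 - alpha).

(* The bilinear extension of the multiplication table of S(alpha,t,E); see
   [Smul_z1z1] to [Smul_EE], [SmulC] and [Smul_linearl] below. *)
Definition Smul x y : Salg E :=
  (z1coef x * z1coef y + '[vecE x, vecE y]) *: z1
  + (z2coef x * z2coef y + t * '[vecE x, vecE y]) *: z2
  + embE ((alpha * z1coef x + alphab * z2coef x) *: vecE y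
         + (alpha * z1coef y + alphab * z2coef y) *: vecE x).

Definition SN x : F :=
  let a := z1coef x in let b := z2coef x in let v := vecE x in
  a * b * (alpha * a + alphab * b) - '[v, v] * (alphab * t * a + alpha * b).

Definition SDelta x y : F :=
  let a := z1coef x in let b := z2coef x in let v := vecE x in
  let k := z1coef y in let l := z2coef y in let u := vecE y in
  alpha * (alpha - 1) * (a - b) * (k - l) - '[u, v] * (alphab + alpha * t).

Definition Ssharp x : Salg E :=
  let a := z1coef x in let b := z2coef x in let v := vecE x in
  (alpha * a + alphab * b) *: (b *: z1 + a *: z2)
  + ((t - 1) * '[v, v]) *: (- alphab *: z1 + alpha *: z2)
  - embE ((alphab * a + alpha * b) *: v).

Definition SN3 x y z : F :=
  SN (x + y + z) - SN (x + y) - SN (x + z) - SN (y + z) + SN x + SN y + SN z.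

Definition ST r : F := SN3 r Sc Sc / 2.
Definition SS r q : F := SN3 r q Sc.
Definition Spair r q : F := ST r * ST q - SS r q - SDelta r q.
Definition Ssharp2 r q : Salg E := Ssharp (r + q) - Ssharp r - Ssharp q.
Definition Sassoc r s q : Salg E := Smul (Smul r s) q - Smul r (Smul s q).

Definition Psi r s q : Salg E :=
  Sassoc r s q - SDelta q s *: r + SDelta r s *: q
  + (4^-1 * (SDelta (Ssharp2 q s) r - SDelta (Ssharp2 r s) q
             + 2 * ST r * SDelta s q - 2 * ST q * SDelta r s
             + Spair (Ssharp2 q s) r - Spair (Ssharp2 r s) q)) *: Sc.

Lemma Salg_ext x y :
  z1coef x = z1coef y -> z2coef x = z2coef y -> vecE x = vecE y -> x = y.
Proof.
by case: x y => [[a b] v] [[k l] u]; rewrite /z1coef /z2coef /vecE /= => -> -> ->.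
Qed.

Lemma z1coefD x y : z1coef (x + y) = z1coef x + z1coef y. Proof. by []. Qed.
Lemma z2coefD x y : z2coef (x + y) = z2coef x + z2coef y. Proof. by []. Qed.
Lemma vecED x y : vecE (x + y) = vecE x + vecE y. Proof. by []. Qed.
Lemma z1coefN x : z1coef (- x) = - z1coef x. Proof. by []. Qed.
Lemma z2coefN x : z2coef (- x) = - z2coef x. Proof. by []. Qed.
Lemma vecEN x : vecE (- x) = - vecE x. Proof. by []. Qed.
Lemma z1coefZ a x : z1coef (a *: x) = a * z1coef x. Proof. by []. Qed.
Lemma z2coefZ a x : z2coef (a *: x) = a * z2coef x. Proof. by []. Qed.
Lemma vecEZ a x : vecE (a *: x) = a *: vecE x. Proof. by []. Qed.
Lemma z1coef_z1 : z1coef z1 = 1. Proof. by []. Qed.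
Lemma z2coef_z1 : z2coef z1 = 0. Proof. by []. Qed.
Lemma vecE_z1 : vecE z1 = 0. Proof. by []. Qed.
Lemma z1coef_z2 : z1coef z2 = 0. Proof. by []. Qed.
Lemma z2coef_z2 : z2coef z2 = 1. Proof. by []. Qed.
Lemma vecE_z2 : vecE z2 = 0. Proof. by []. Qed.
Lemma z1coef_embE v : z1coef (embE v) = 0. Proof. by []. Qed.
Lemma z2coef_embE v : z2coef (embE v) = 0. Proof. by []. Qed.
Lemma vecE_embE v : vecE (embE v) = v. Proof. by []. Qed.

Definition ScoefE :=
  (z1coefD, z2coefD, vecED, z1coefN, z2coefN, vecEN, z1coefZ, z2coefZ, vecEZ,
   (z1coef_z1, z2coef_z1, vecE_z1, z1coef_z2, z2coef_z2, vecE_z2),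
   (z1coef_embE, z2coef_embE, vecE_embE)).

Definition Slin0E := (scaler0, scale0r, linear0l, linear0r, addr0, add0r,
  mulr0, mul0r, mulr1, mul1r, scale1r, oppr0).

Lemma form_sym u v : '[u, v] = '[v, u].
Proof. by rewrite hermC expr0 mul1r. Qed.

Lemma Smul_z1z1 : Smul z1 z1 = z1.
Proof. by apply: Salg_ext; rewrite /Smul !ScoefE !Slin0E. Qed.

Lemma Smul_z2z2 : Smul z2 z2 = z2.
Proof. by apply: Salg_ext; rewrite /Smul !ScoefE !Slin0E. Qed.

Lemma Smul_z1z2 : Smul z1 z2 = 0.
Proof. by apply: Salg_ext; rewrite /Smul !ScoefE !Slin0E. Qed.

Lemma Smul_Ez1 v : Smul (embE v) z1 = alpha *: embE v.
Proof. by apply: Salg_ext; rewrite /Smul !ScoefE !Slin0E. Qed.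

Lemma Smul_Ez2 v : Smul (embE v) z2 = alphab *: embE v.
Proof. by apply: Salg_ext; rewrite /Smul !ScoefE !Slin0E. Qed.

Lemma Smul_EE u v : Smul (embE u) (embE v) = '[u, v] *: (z1 + t *: z2).
Proof.
by apply: Salg_ext; rewrite /Smul !ScoefE !Slin0E // mulrC.
Qed.

Lemma SmulC x y : Smul x y = Smul y x.
Proof.
rewrite /Smul form_sym [z1coef x * _]mulrC [z2coef x * _]mulrC.
by congr (_ + embE _); rewrite addrC.
Qed.

Lemma Smul_linearl k x y z : Smul (k *: x + y) z = k *: Smul x z + Smul y z.
Proof.
apply: Salg_ext; rewrite /Smul !ScoefE !Slin0E.
- by rewrite linearDl linearZl_LR; ring.
- by rewrite linearDl linearZl_LR; ring.
- rewrite !scalerDr !scalerA addrACA -!scalerDl; congr (_ *: _ + _).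
    by ring.
  by rewrite [k * _]mulrC.
Qed.

Lemma SNE a b v : SN (a *: z1 + b *: z2 + embE v) =
  a * b * (alpha * a + alphab * b) - '[v, v] * (alphab * t * a + alpha * b).
Proof. by rewrite /SN !ScoefE !Slin0E. Qed.

Lemma SDeltaE a b v k l u :
  SDelta (a *: z1 + b *: z2 + embE v) (k *: z1 + l *: z2 + embE u) =
  alpha * (alpha - 1) * (a - b) * (k - l) - '[u, v] * (alphab + alpha * t).
Proof. by rewrite /SDelta !ScoefE !Slin0E. Qed.

Lemma SsharpE a b v : Ssharp (a *: z1 + b *: z2 + embE v) =
  (alpha * a + alphab * b) *: (b *: z1 + a *: z2)
  + ((t - 1) * '[v, v]) *: (- alphab *: z1 + alpha *: z2)
  - (alphab * a + alpha * b) *: embE v.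
Proof.
by apply: Salg_ext; rewrite /Ssharp !ScoefE !Slin0E.
Qed.

End SAlgebra.

Arguments z1 {F E}.
Arguments z2 {F E}.
Arguments Sc {F E}.

(* Main.v *)
Require Import Defs.
From mathcomp Require Import all_boot all_order all_algebra.
From mathcomp Require Import ring.
Import GRing.Theory.
Local Open Scope ring_scope.

(** Write [wt x = alpha a + (1 - alpha) b] for [x = a z1 + b z2 + v].  The
    [E]-component of the associator [(r,s,q)] is
    [(wt (r s) - wt r wt s) w - (wt (s q) - wt s wt q) v], and the
    multiplicativity defect [wt (r s) - wt r wt s] differs from
    [- Delta(r,s)] only by a multiple of [<v,u>]; this leaves the right-hand
    side.  The [z1]- and [z2]-components of
    [(r,s,q) - Delta(q,s) r + Delta(r,s) q] coincide and are cancelled by the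
    multiple of [c] in [Psi], which is computed from [(r,q) = T(r q)]. *)

Section SharpedCubicForm.
Variables (F : fieldType) (E : lmodType F) (form : {symmetric E}).
Variables (alpha t : F).
Implicit Types r s q x y : Salg E.

Local Notation Smul := (Smul alpha t form).
Local Notation SDelta := (SDelta alpha t form).
Local Notation Sassoc := (Sassoc alpha t form).
Local Notation ST := (ST alpha t form).
Local Notation Spair := (Spair alpha t form).
Local Notation Ssharp2 := (Ssharp2 alpha t form).

(** The scalar by which the [Fz1 + Fz2] part of [x] acts on [E]. *)
Definition wt x : F := alpha * z1coef x + (1 - alpha) * z2coef x.

Lemma SmulE x y :
  (z1coef (Smul x y) = z1coef x * z1coef y + form (vecE x) (vecE y))
  * (z2coef (Smul x y) = z2coef x * z2coef y + t * form (vecE x) (vecE y))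
  * (vecE (Smul x y) = wt x *: vecE y + wt y *: vecE x).
Proof. by rewrite /Defs.Smul !ScoefE !Slin0E. Qed.

(** On [Fz1 + Fz2] the defect is a weighted covariance, exactly [- SDelta]. On [E], [wt] gives
    [z1 + t z2] the weight [alpha + (1 - alpha) t], while [- SDelta] carries
    [(1 - alpha) + alpha t]; their difference is the last coefficient. *)
Lemma wt_Smul x y :
  wt (Smul x y) = wt x * wt y - SDelta x y
    + (2 * alpha - 1) * (1 - t) * form (vecE x) (vecE y).
Proof. by rewrite /wt !SmulE /Defs.SDelta (form_sym form (vecE y)); ring. Qed.

Lemma vecE_Sassoc r s q :
  vecE (Sassoc r s q) = (wt (Smul r s) - wt r * wt s) *: vecE q
                      - (wt (Smul s q) - wt s * wt q) *: vecE r.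
Proof.
rewrite /Defs.Sassoc vecED vecEN !SmulE !(scalerDr, scalerBl, scalerA).
rewrite addrA [wt q * wt r]mulrC [wt q * wt s]mulrC.
(* Both products contain [(wt r * wt q) *: vecE s], which cancels here. *)
rewrite [X in X - _]addrAC [X in _ - X]addrAC opprD addrACA subrr addr0.
by rewrite opprB opprD addrACA.
Qed.

(** [Fz1 + Fz2] is associative and the terms in [form (vecE r) (vecE q)] cancel; the rest uses that
    [z1coef x - wt x] is [1 - alpha] times [z1coef x - z2coef x]. *)
Lemma z1coef_Sassoc r s q :
  z1coef (Sassoc r s q) =
  (1 - alpha) * (form (vecE r) (vecE s) * (z1coef q - z2coef q)
                 - form (vecE s) (vecE q) * (z1coef r - z2coef r)).
Proof.
rewrite /Defs.Sassoc z1coefD z1coefN !SmulE.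
by rewrite !(linearDl, linearDr, linearZl_LR, linearZr_LR) /= /wt; ring.
Qed.

Lemma z2coef_Sassoc r s q :
  z2coef (Sassoc r s q) =
  alpha * t * (form (vecE s) (vecE q) * (z1coef r - z2coef r)
             - form (vecE r) (vecE s) * (z1coef q - z2coef q)).
Proof.
rewrite /Defs.Sassoc z2coefD z2coefN !SmulE.
by rewrite !(linearDl, linearDr, linearZl_LR, linearZr_LR) /= /wt; ring.
Qed.

(** Serves both [SS] and, at [q = Sc], the trace [ST]. *)
Lemma SN3_Sc r q :
  SN3 alpha t form r q Sc =
  2 * (alpha * z1coef r * z1coef q + (1 - alpha) * z2coef r * z2coef q
       + z1coef r * z2coef q + z2coef r * z1coef q
       - ((1 - alpha) * t + alpha) * form (vecE r) (vecE q)).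
Proof.
rewrite /SN3 /SN /Sc !ScoefE !Slin0E !(linearDl, linearDr) /=.
by rewrite (form_sym form (vecE q)); ring.
Qed.

Lemma Ssharp2E x y :
  let m := form (vecE x) (vecE y) in
  (z1coef (Ssharp2 x y) = wt x * z2coef y + wt y * z2coef x
                          - 2 * (t - 1) * (1 - alpha) * m)
  * (z2coef (Ssharp2 x y) = wt x * z1coef y + wt y * z1coef x
                          + 2 * (t - 1) * alpha * m).
Proof.
rewrite /Defs.Ssharp2 /Ssharp /wt; split; rewrite !ScoefE !Slin0E.
- by rewrite !(linearDl, linearDr) /= (form_sym form (vecE y)); ring.
- by rewrite !(linearDl, linearDr) /= (form_sym form (vecE y)); ring.
Qed.

(** [SDelta] and [Spair] see the [E]-component only through [form], so scalar identities suffice. *)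
Lemma form_Ssharp2 x y u :
  form (vecE (Ssharp2 x y)) u =
  - (((1 - alpha) * z1coef x + alpha * z2coef x) * form (vecE y) u
     + ((1 - alpha) * z1coef y + alpha * z2coef y) * form (vecE x) u).
Proof.
rewrite /Defs.Ssharp2 /Ssharp !ScoefE !Slin0E.
by rewrite !(linearDl, linearNl, linearZl_LR) /=; ring.
Qed.

Hypothesis F2 : (2 : F) != 0.

Lemma STE r : ST r = (1 + alpha) * z1coef r + (2 - alpha) * z2coef r.
Proof. by rewrite /Defs.ST SN3_Sc /Sc !ScoefE !Slin0E; field. Qed.

Lemma SpairE r q : Spair r q = ST (Smul r q).
Proof.
rewrite /Defs.Spair /SS SN3_Sc !STE !SmulE /Defs.SDelta.
by rewrite (form_sym form (vecE q)); ring.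
Qed.

Lemma Psi_Sc_coef r s q :
  4^-1 * (SDelta (Ssharp2 q s) r - SDelta (Ssharp2 r s) q
          + 2 * ST r * SDelta s q - 2 * ST q * SDelta r s
          + Spair (Ssharp2 q s) r - Spair (Ssharp2 r s) q) =
  alpha * (1 - alpha) * (z1coef s - z2coef s)
    * (z1coef r * z2coef q - z2coef r * z1coef q)
  + form (vecE r) (vecE s) * (alpha * t * z1coef q + (1 - alpha) * z2coef q)
  - form (vecE s) (vecE q) * (alpha * t * z1coef r + (1 - alpha) * z2coef r).
Proof.
have F4 : (4 : F) != 0 by rewrite (natrM _ 2 2) mulf_neq0.
rewrite !SpairE !STE !SmulE /Defs.SDelta !Ssharp2E !form_Ssharp2.
(* [SDelta] pairs its arguments in reverse order; this moves the sharp products to the left. *)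
rewrite !(form_sym form _ (vecE (Ssharp2 _ _))) !form_Ssharp2.
rewrite (form_sym form (vecE q) (vecE s)) (form_sym form (vecE q) (vecE r)).
by rewrite (form_sym form (vecE s) (vecE r)) /wt; field.
Qed.

Lemma PsiE r s q :
  Psi alpha t form r s q =
  ((2 * alpha - 1) * (t - 1)) *:
    embE (form (vecE s) (vecE q) *: vecE r - form (vecE r) (vecE s) *: vecE q).
Proof.
rewrite /Psi Psi_Sc_coef /Sc; apply: Salg_ext.
- rewrite 3!z1coefD z1coef_Sassoc z1coefN !ScoefE !Slin0E /Defs.SDelta.
  by rewrite (form_sym form (vecE s) (vecE r)); ring.
- rewrite 3!z2coefD z2coef_Sassoc z2coefN !ScoefE !Slin0E /Defs.SDelta.
  by rewrite (form_sym form (vecE s) (vecE r)); ring.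
rewrite 3!vecED vecE_Sassoc vecEN !ScoefE !Slin0E !wt_Smul.
(* Collecting the coefficients of [vecE q] and [vecE r] lets each [SDelta] cancel the one produced
   by [wt_Smul]. *)
rewrite addrAC [X in X - _]addrAC -scalerDl -addrA -opprD -scalerDl.
rewrite scalerBr !scalerA addrC -!scaleNr; congr (_ *: _ + _ *: _).
  by rewrite /Defs.SDelta (form_sym form (vecE q)); ring.
by ring.
Qed.
End SharpedCubicForm.

Theorem lemma9 (F : fieldType) (E : lmodType F) (form : {symmetric E})
    (alpha t : F)
    (char_neq2 : 2%N \notin [pchar F]) (char_neq3 : 3%N \notin [pchar F])
    (form_nondeg : nondegenerate_form form)
    (r0 s0 q0 : Salg E)
    (r0_in : in_Fz1z2 r0) (s0_in : in_Fz1z2 s0) (q0_in : in_Fz1z2 q0)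
    (v u w : E) :
  let r := r0 + embE v in let s := s0 + embE u in let q := q0 + embE w in
  Psi alpha t form r s q =
    ((2 * alpha - 1) * (t - 1)) *: embE (form u w *: v - form u v *: w).
Proof.
have F2 : (2 : F) != 0 by move: char_neq2; rewrite inE /=.
have vecE_in x0 x : in_Fz1z2 x0 -> vecE (x0 + embE x) = x.
  by case=> a [b ->]; rewrite !ScoefE !Slin0E.
by move=> r s q; rewrite PsiE // !vecE_in // (form_sym form v).
Qed.
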